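(* The Minkowski (box-counting) dimension of $X_\Omega$ with respect to $d$ exists and $$ \dim_M(X_\Omega)=(q-1)^2\sum_{p=1}^j\frac{\log_{m_2}(|\mathrm{Pref}_{0,p}(\Omega)|)}{q^{p+1}}+(q-1)(1-q^j\gamma)\sum_{p=j+1}^\infty\frac{\log_{m_2}(|\mathrm{Pref}_{p-j-1,j+1}(\Omega)|)}{q^p}+(q-1)(q^{j+1}\gamma-1)\sum_{p=j+1}^\infty\frac{\log_{m_2}(|\mathrm{Pref}_{p-j,j}(\Omega)|)}{q^{p+1}}. $$
   Context: Let $q\ge 2$ and $m_1>m_2\ge 2$ be integers, $\mathcal{A}_i=\{0,\dots,m_i-1\}$, $\mathbb{N}^*=\{1,2,\dots\}$, $\Sigma_{m_1,m_2}=(\mathcal{A}_1\times\mathcal{A}_2)^{\mathbb{N}^*}$, with elements $(x,y)=(x_k,y_k)_{k\ge1}$. Put $\gamma=\log(m_2)/\log(m_1)$, $L(n)=\lceil n/\gamma\rceil$, and let $j$ be the unique non-negative integer with $q^j\le 1/\gamma<q^{j+1}$. Metric: $d((x,y),(u,v))=\max\left(m_1^{-\min\{k\ge0:(x_{k+1},y_{k+1})\ne(u_{k+1},v_{k+1})\}},\ m_1^{-\gamma\min\{k\ge0:y_{k+1}\ne v_{k+1}\}}\right)$ (with $m_1^{-\infty}=0$); the closed ball of radius $m_1^{-n}$ is $B_n(x,y)=\{(u,v): u_k=x_k\ \forall k\le n,\ v_k=y_k\ \forall k\le L(n)\}$. For $u=(x_1,y_1)\cdots(x_p,y_p)y_{p+1}\cdots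 y_{p+\ell}$ ($p,\ell\ge0$), the generalized cylinder $[u]$ is the set of sequences of $\Sigma_{m_1,m_2}$ whose first $p$ letters are $(x_1,y_1),\dots,(x_p,y_p)$ and whose second coordinates at positions $p+1,\dots,p+\ell$ are $y_{p+1},\dots,y_{p+\ell}$. For $Y\subset\Sigma_{m_1,m_2}$, $\mathrm{Pref}_{p,\ell}(Y)$ is the set of such $u$ with $Y\cap[u]\ne\varnothing$. Lower and upper Minkowski dimensions of $Y$ are the $\liminf$ and $\limsup$ of $\frac1n\log_{m_1}|\mathrm{Pref}_{n,L(n)-n}(Y)|$ (the number of balls $B_n$ needed to cover $Y$); $\dim_M(Y)$ is their common value when they agree. Let $\Omega\subset\Sigma_{m_1,m_2}$ be nonempty and closed (product topology), and $X_\Omega=\{(x_k,y_k)_{k\ge1}:(x_{iq^\ell},y_{iq^\ell})_{\ell\ge0}\in\Omega\ \forall i\ge1,\ q\nmid i\}$. *)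

(* Defs.v *)
From HB Require Import structures.
From mathcomp Require Import all_boot all_order all_algebra.
From mathcomp Require Import all_classical all_reals all_analysis.

Set Implicit Arguments.
Unset Strict Implicit.
Unset Printing Implicit Defensive.

Import Order.TTheory GRing.Theory Num.Theory.
Import numFieldNormedType.Exports.

Local Open Scope classical_set_scope.
Local Open Scope ring_scope.

(* Positions of a sequence are 1, 2, 3, ... in the mathematical notation but
   0, 1, 2, ... here: the k-th letter (x_k, y_k) of z, k >= 1, is [z k.-1]. *)
Definition Sigma (m1 m2 : nat) : Type :=
  prod_topology (fun _ : nat => discrete_topology ('I_m1 * 'I_m2)%type).

HB.instance Definition _ (m1 m2 : nat) := Topological.on (Sigma m1 m2).

Definition letter (m1 m2 : nat) (z : Sigma m1 m2) (k : nat) : 'I_m1 * 'I_m2 :=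
  z k.-1.

Definition word (m1 m2 p l : nat) : finType :=
  (p.-tuple ('I_m1 * 'I_m2) * l.-tuple 'I_m2)%type.

Definition cylinder (m1 m2 p l : nat) (u : word m1 m2 p l) :
    set (Sigma m1 m2) :=
  [set z | (forall k : 'I_p, letter z k.+1 = tnth u.1 k) /\
           (forall k : 'I_l, (letter z (p + k).+1).2 = tnth u.2 k)].

Definition Pref (m1 m2 p l : nat) (Y : set (Sigma m1 m2)) :
    {set word m1 m2 p l} :=
  [set u : word m1 m2 p l | `[< Y `&` cylinder u !=set0 >]]%SET.

Definition X_ (m1 m2 q : nat) (Omega : set (Sigma m1 m2)) :
    set (Sigma m1 m2) :=
  [set z | forall i : nat, (1 <= i)%N -> ~~ (q %| i)%N ->
     Omega (fun l : nat => letter z (i * q ^ l))].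

Definition logb (R : realType) (b x : R) : R := ln x / ln b.

Definition gamma (R : realType) (m1 m2 : nat) : R := ln m2%:R / ln m1%:R.

Definition L (R : realType) (m1 m2 n : nat) : nat :=
  `|Num.ceil (n%:R / gamma R m1 m2)|%N.

(* [Pref n (L n - n) Y] indexes the balls of radius m1 ^ (- n) meeting Y for
   the metric max (m1 ^ - min {k | (x_(k+1), y_(k+1)) <> (u_(k+1), v_(k+1))},
   m1 ^ (- gamma * min {k | y_(k+1) <> v_(k+1)})), since such a ball fixes n
   letters and L n second coordinates.  Here n <= L n because gamma < 1. *)
Definition log_cover (R : realType) (m1 m2 : nat) (Y : set (Sigma m1 m2))
    (n : nat) : R :=
  n%:R^-1 * logb m1%:R #|Pref n (L R m1 m2 n - n) Y|%:R.

Definition lower_minkowski_dim (R : realType) (m1 m2 : nat)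
    (Y : set (Sigma m1 m2)) : \bar R :=
  limn_einf (fun n => (log_cover R Y n)%:E).

Definition upper_minkowski_dim (R : realType) (m1 m2 : nat)
    (Y : set (Sigma m1 m2)) : \bar R :=
  limn_esup (fun n => (log_cover R Y n)%:E).

Definition has_minkowski_dim (R : realType) (m1 m2 : nat)
    (Y : set (Sigma m1 m2)) (D : \bar R) : Prop :=
  lower_minkowski_dim R Y = D /\ upper_minkowski_dim R Y = D.

(* Main.v *)
Require Import Defs.
From mathcomp Require Import all_boot all_order all_algebra.
From mathcomp Require Import all_classical all_reals all_analysis.
From mathcomp Require Import zify ring lra.

Set Implicit Arguments.
Unset Strict Implicit.
Unset Printing Implicit Defensive.

Import Order.TTheory GRing.Theory Num.Theory.
Import numFieldNormedType.Exports.

Local Open Scope classical_set_scope.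
Local Open Scope ring_scope.

(** Write N = L n.  Every position k >= 1 is i * q ^ l for exactly one pair
    (i, l) with q not dividing i, so a point of X_Omega is nothing but a free
    choice, for each such i, of a sequence of Omega put on the positions
    i, i q, i q^2, ...  The word of a point that records n letters and N second
    coordinates records, on the i-th of these progressions, a letters and b
    second coordinates, where a and b are the numbers of l with i q^l <= n and
    i q^l <= N.  The number of balls of radius m1^-n meeting X_Omega is
    therefore the product of the |Pref_(a, b - a)(Omega)| over i <= N with q not
    dividing i ([card_Pref_X]).

    Taking logarithms turns the product into a sum over i, which is grouped by
    the value s + 1 of b, that is, by N / q^(s+1) < i <= N / q^s.  Because
    q^j <= 1 / gamma < q^(j+1), one has n q^j <= N <= n q^(j+1); so in this
    group i > n, hence a = 0, when s < j, whereas for s >= j the number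
    n / q^(s-j) lies between the two ends and separates the indices with
    a = s + 1 - j from those with a = s - j ([sum_nterms]).  On each piece the
    summand is constant, and an interval (x, y] contains about
    (1 - 1/q) (y - x) integers not divisible by q.  Since N / n tends to
    1 / gamma, the s-th group divided by n tends to the term p = s + 1 of the
    formula ([cvg_block_sum]).

    The limit may be taken inside the sum over s by dominated convergence for
    series ([tannery]): the s-th group has O(n / q^s) indices and
    log |Pref_(a, b - a)(Omega)| = O(s + 1), so after division by n the groups
    are bounded by a convergent geometric series. *)

(** * Counting the prefixes of X_Omega *)

(** If g determines f on Y, then f takes on Y at most as many values as g.  Two
    maps that separate the same points of Y thus have equally many values, which
    lets a product of words be counted in place of a word without writing a
    bijection between the two types. *)
Lemma leq_card_factor (Z : Type) (A B : finType) (Y : set Z) (f : Z -> A)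
    (g : Z -> B) (SA : {set A}) (SB : {set B}) :
  (forall a, a \in SA -> exists2 z, Y z & f z = a) ->
  (forall z, Y z -> g z \in SB) ->
  (forall z z', Y z -> Y z' -> g z = g z' -> f z = f z') ->
  (#|SA| <= #|SB|)%N.
Proof.
move=> fY gY gf.
have [->|[a0 /fY[z0 _ _]]] := set_0Vmem SA; first by rewrite cards0.
have /choice[r rP] a : exists z, a \in SA -> Y z /\ f z = a.
  case: (boolP (a \in SA)) => [/fY[z Yz fz]|_]; first by exists z.
  by exists z0.
rewrite -(card_in_imset (f := g \o r)).
  apply/subset_leq_card/fintype.subsetP => _ /imsetP[a /rP[Ya _] ->].
  exact: gY.
move=> a b /rP[Ya fa] /rP[Yb fb] gab.
by rewrite -fa -fb; exact: gf.
Qed.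

Definition prefix_word (m1 m2 p l : nat) (z : Sigma m1 m2) : word m1 m2 p l :=
  ([tuple letter z k.+1 | k < p], [tuple (letter z (p + k).+1).2 | k < l]).

(** Agreement on p letters and N second coordinates, both counted from the
    first position: unlike the words of [Pref p (N - p)], this form restricts to
    a progression without any subtraction. *)
Definition agree (m1 m2 p N : nat) (z z' : Sigma m1 m2) : Prop :=
  (forall k, (k < p)%N -> letter z k.+1 = letter z' k.+1) /\
  (forall k, (k < N)%N -> (letter z k.+1).2 = (letter z' k.+1).2).

Lemma cylinderE (m1 m2 p l : nat) (u : word m1 m2 p l) (z : Sigma m1 m2) :
  cylinder u z <-> prefix_word p l z = u.
Proof.
case: u => u v; rewrite /cylinder /prefix_word /=; split=> [[zu zv]|[<- <-]].
  congr pair; apply: eq_from_tnth => k; rewrite tnth_mktuple; first exact: zu.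
  exact: zv.
by split=> k; rewrite tnth_mktuple.
Qed.

Lemma PrefP (m1 m2 p l : nat) (Y : set (Sigma m1 m2)) (u : word m1 m2 p l) :
  reflect (exists2 z, Y z & prefix_word p l z = u) (u \in Pref p l Y).
Proof.
rewrite inE; apply: (iffP (asboolP _)) => [[z [Yz /cylinderE zu]]|[z Yz zu]].
  by exists z.
by exists z; split=> //; apply/cylinderE.
Qed.

Lemma prefix_word_agree (m1 m2 p N : nat) (z z' : Sigma m1 m2) :
  (p <= N)%N ->
  prefix_word p (N - p) z = prefix_word p (N - p) z' <-> agree p N z z'.
Proof.
move=> pN; split=> [zz'|[zz'1 zz'2]]; last first.
  congr pair; apply: eq_from_tnth => k; rewrite !tnth_mktuple.
    exact: zz'1.
  by apply: zz'2; rewrite -ltn_subRL ltn_ord.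
have fstE k : (k < p)%N -> letter z k.+1 = letter z' k.+1.
  move=> kp; have /(congr1 (fun w => tnth w.1 (Ordinal kp))) := zz'.
  by rewrite !tnth_mktuple.
split=> // k kN; have [kp|pk] := ltnP k p; first by rewrite fstE.
have kp : (k - p < N - p)%N by rewrite ltn_sub2r // (leq_ltn_trans pk).
have /(congr1 (fun w => tnth w.2 (Ordinal kp))) := zz'.
by rewrite !tnth_mktuple /= subnKC.
Qed.

Definition fiber (m1 m2 q : nat) (z : Sigma m1 m2) (i : nat) : Sigma m1 m2 :=
  fun l => letter z (i * q ^ l).

(** The number of l with i * q ^ l <= n.  It is set to 0 when q divides i, so
    that such an i contributes only the empty word and indices can range over
    all of 1, ..., N. *)
Definition nterms (q n i : nat) : nat :=
  if (q %| i)%N then 0 else up_log q (n %/ i).+1.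

Lemma ltn_nterms (q n i l : nat) : (1 < q)%N -> (0 < i)%N ->
  (l < nterms q n i)%N = ~~ (q %| i)%N && (i * q ^ l <= n)%N.
Proof.
move=> q1 i0; rewrite /nterms; case: ifP => //= qi.
rewrite [(i * _)%N]mulnC -leq_divRL //.
apply/idP/idP => [|h]; last first.
  rewrite ltnNge; apply/negP => lq.
  have := leq_trans (up_logP (n %/ i).+1 q1) (leq_pexp2l (ltnW q1) lq).
  by rewrite ltnNge h.
by apply: contraTT; rewrite -leqNgt -ltnNge => h; exact: up_log_min.
Qed.

Lemma leq_nterms (q n N i : nat) : (n <= N)%N ->
  (nterms q n i <= nterms q N i)%N.
Proof.
move=> nN; rewrite /nterms; case: ifP => // _.
by apply: leq_up_log; rewrite ltnS leq_div2r.
Qed.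

(** Here q need not be prime, so this is not a valuation; dividing by q as long
    as possible still gives existence and, below, uniqueness. *)
Lemma qfree_decomp (q k : nat) : (1 < q)%N -> (0 < k)%N ->
  exists il : nat * nat,
    [/\ (0 < il.1)%N, ~~ (q %| il.1)%N & k = (il.1 * q ^ il.2)%N].
Proof.
move=> q1; elim/ltn_ind: k => k IH k0.
have [/dvdnP[k' kE]|qk] := boolP (q %| k)%N; last first.
  by exists (k, 0%N); rewrite /= expn0 muln1.
have k'0 : (0 < k')%N by move: k0; rewrite kE; case: k' {kE}.
have [|[i l] [/= i0 qi k'E]] := IH k' _ k'0; first by rewrite kE ltn_Pmulr.
by exists (i, l.+1); split=> //=; rewrite kE k'E expnSr mulnA.
Qed.

Lemma qfree_decomp_inj (q i i' l l' : nat) : (1 < q)%N ->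
  ~~ (q %| i)%N -> ~~ (q %| i')%N -> (i * q ^ l = i' * q ^ l')%N ->
  i = i' /\ l = l'.
Proof.
move=> q1 qi qi'; elim: l l' => [|l IH] [|l']; rewrite ?expn0 ?muln1.
- by [].
- by move=> iE; move: qi; rewrite iE expnSr mulnA dvdn_mull.
- by move=> iE; move: qi'; rewrite -iE expnSr mulnA dvdn_mull.
rewrite !expnSr !mulnA => /eqP; rewrite eqn_pmul2r ?(ltnW q1) //.
by move=> /eqP /IH[-> ->].
Qed.

(** The progressions i, i q, i q^2, ... cover all positions, and position i q^l
    is recorded exactly when the l-th place of progression i is. *)
Lemma agree_fiber (m1 m2 q n N : nat) (z z' : Sigma m1 m2) :
  (1 < q)%N -> (n <= N)%N ->
  agree n N z z' <->
  (forall i, (0 < i <= N)%N ->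
     agree (nterms q n i) (nterms q N i) (fiber q z i) (fiber q z' i)).
Proof.
move=> q1 nN.
have dec k (h : (k < N)%N) : exists i l, [/\ (0 < i <= N)%N,
    ~~ (q %| i)%N & k.+1 = (i * q ^ l)%N].
  have [[i l] [/= i0 qi kE]] := qfree_decomp q1 (ltn0Sn k).
  exists i, l; rewrite i0 qi; split=> //.
  by rewrite (leq_trans _ h) // kE leq_pmulr // expn_gt0 (ltnW q1).
split=> [[zz1 zz2] i /andP[i0 _]|zz].
  have pos l : (0 < i * q ^ l)%N by rewrite muln_gt0 i0 expn_gt0 (ltnW q1).
  split=> l; rewrite ltn_nterms // => /andP[_]; rewrite /fiber /letter /= => le.
    by have := zz1 (i * q ^ l).-1; rewrite prednK //; exact.
  by have := zz2 (i * q ^ l).-1; rewrite prednK //; exact.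
split=> k kn.
  have [i [l [iN qi kE]]] := dec k (leq_trans kn nN).
  have [+ _] := zz _ iN; move/(_ l); rewrite ltn_nterms ?qi -?kE //=; last first.
    by case/andP: iN.
  by move=> /(_ kn); rewrite /letter /fiber /= -kE.
have [i [l [iN qi kE]]] := dec k kn.
have [_] := zz _ iN; move/(_ l); rewrite ltn_nterms ?qi -?kE //=; last first.
  by case/andP: iN.
by move=> /(_ kn); rewrite /letter /fiber /= -kE.
Qed.

(** The progressions are disjoint, so the sequences put on them are
    independent. *)
Lemma X_glue (m1 m2 q : nat) (Omega : set (Sigma m1 m2))
    (w : nat -> Sigma m1 m2) : (1 < q)%N -> (forall i, Omega (w i)) ->
  exists2 z, X_ q Omega z &
    forall i, (0 < i)%N -> ~~ (q %| i)%N -> fiber q z i = w i.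
Proof.
move=> q1 Ow.
have /choice[d dP] k : exists il : nat * nat,
    [/\ (0 < il.1)%N, ~~ (q %| il.1)%N & k.+1 = (il.1 * q ^ il.2)%N].
  exact: qfree_decomp.
pose z : Sigma m1 m2 := fun k => w (d k).1 (d k).2.
have zE i : (0 < i)%N -> ~~ (q %| i)%N -> fiber q z i = w i.
  move=> i0 qi; apply/funext => l; rewrite /fiber /letter /z.
  have pos : (0 < i * q ^ l)%N by rewrite muln_gt0 i0 expn_gt0 (ltnW q1).
  have [_ qd] := dP (i * q ^ l).-1; rewrite prednK // => dE.
  by have [<- <-] := qfree_decomp_inj q1 qi qd dE.
exists z => // i i0 qi; have := zE i i0 qi; rewrite /fiber => ->; exact: Ow.
Qed.

Lemma card_Pref00 (m1 m2 : nat) (Y : set (Sigma m1 m2)) : Y !=set0 ->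
  #|Pref 0 0 Y| = 1%N.
Proof.
move=> [z Yz]; apply/eqP/cards1P; exists (prefix_word 0 0 z).
apply/setP => u; rewrite [RHS]inE; apply/PrefP/eqP => [_|->]; last by exists z.
by case: u => u v; congr pair; apply: eq_from_tnth => -[].
Qed.

Lemma card_Pref_X (m1 m2 q n N : nat) (Omega : set (Sigma m1 m2)) :
  (1 < q)%N -> (n <= N)%N -> Omega !=set0 ->
  #|Pref n (N - n) (X_ q Omega)| =
  (\prod_(1 <= i < N.+1 | ~~ (q %| i))
     #|Pref (nterms q n i) (nterms q N i - nterms q n i) Omega|)%N.
Proof.
move=> q1 nN [w0 Ow0].
pose wd i := prefix_word (m1 := m1) (m2 := m2) (nterms q n i)
  (nterms q N i - nterms q n i).
pose A (i : 'I_N) :=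
  Pref (nterms q n i.+1) (nterms q N i.+1 - nterms q n i.+1) Omega.
transitivity #|setXn A|; last first.
  rewrite cardsXn big_add1 /= big_mkord [RHS]big_mkcond /=.
  apply: eq_bigr => i _; rewrite /A; case: ifPn => // /negPn qi.
  by rewrite /nterms qi card_Pref00 //; exists w0.
pose g z : {dffun forall i : 'I_N, word m1 m2 (nterms q n i.+1)
    (nterms q N i.+1 - nterms q n i.+1)} :=
  [ffun i : 'I_N => wd i.+1 (fiber q z i.+1)].
have gE z z' :
    g z = g z' <-> prefix_word n (N - n) z = prefix_word n (N - n) z'.
  rewrite prefix_word_agree // (agree_fiber _ _ q1 nN); split=> [gz i|h].
    move=> /andP[i0 iN]; have iN' : (i.-1 < N)%N by rewrite prednK.
    move: gz => /ffunP /(_ (Ordinal iN')); rewrite !ffunE /= prednK //.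
    by move/prefix_word_agree; apply; exact: leq_nterms.
  apply/ffunP => i; rewrite !ffunE; apply/prefix_word_agree.
    exact: leq_nterms.
  by apply: h; rewrite /= ltn_ord.
apply/eqP; rewrite eqn_leq; apply/andP; split.
  apply: (@leq_card_factor _ _ _ (X_ q Omega) (prefix_word n (N - n)) g).
  - by move=> u /PrefP.
  - move=> z Xz; rewrite inE /=; apply/forallP => i; rewrite ffunE.
    have [qi|qi] := boolP (q %| i.+1)%N; last first.
      by apply/PrefP; exists (fiber q z i.+1) => //; exact: Xz.
    apply/PrefP; exists w0 => //; rewrite /wd /nterms qi /=.
    by apply/(prefix_word_agree _ _ (leqnn 0)); split.
  - by move=> z z' _ _ /gE.
apply: (@leq_card_factor _ _ _ (X_ q Omega) g (prefix_word n (N - n))).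
- move=> u; rewrite inE => /forallP uA.
  have /choice[w wP] (i : 'I_N) : exists w, Omega w /\ wd i.+1 w = u i.
    by have /PrefP[w Ow wE] := uA i; exists w.
  (* w0 fills the progressions i > N, on which nothing is recorded. *)
  pose w' k := oapp w w0 (insub k.-1).
  have [|z Xz zE] := @X_glue _ _ q Omega w' q1.
    by move=> k; rewrite /w'; case: insub => //= i; exact: (wP i).1.
  exists z => //; apply/ffunP => i; rewrite ffunE -(wP i).2.
  have [qi|qi] := boolP (q %| i.+1)%N; last by rewrite zE // /w' /= valK.
  rewrite /wd /nterms qi /=; exact/(prefix_word_agree _ _ (leqnn 0)).
- by move=> z Xz; apply/PrefP; exists z.
- by move=> z z' _ _ /gE.
Qed.

(** * Grouping the indices by the number of recorded coordinates *)

Lemma nterms_gt (q n i s : nat) : (1 < q)%N -> (0 < i)%N -> ~~ (q %| i)%N ->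
  (i <= n %/ q ^ s)%N -> (s < nterms q n i)%N.
Proof.
by move=> q1 i0 qi; rewrite ltn_nterms // qi leq_divRL // expn_gt0 (ltnW q1).
Qed.

Lemma nterms_le (q n i s : nat) : (1 < q)%N -> (n %/ q ^ s < i)%N ->
  (nterms q n i <= s)%N.
Proof.
move=> q1 ni; rewrite leqNgt ltn_nterms //; last exact: leq_ltn_trans ni.
by rewrite negb_and -ltnNge -ltn_divLR ?expn_gt0 ?(ltnW q1) // ni orbT.
Qed.

Definition qfree_count (q x : nat) : nat := (x - x %/ q)%N.

(** x %/ q counts the multiples of q in 1, ..., x. *)
Lemma qfree_countE (R : realType) (q x : nat) : (0 < q)%N ->
  (qfree_count q x)%:R = \sum_(1 <= i < x.+1 | ~~ (q %| i)%N) 1 :> R.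
Proof.
move=> q0; rewrite -(natr_sum _ _ _ (fun=> 1%N)); congr _%:R.
elim: x => [|x IH].
  by rewrite big_nil /qfree_count sub0n.
rewrite big_mkcond big_nat_recr //= -big_mkcond /= -IH /qfree_count divnS //.
have := leq_div x q; case: ifPn => [qx|/negPn ->] /=; last by lia.
by rewrite (negbTE qx); lia.
Qed.

Lemma sum_qfree_const (R : realType) (q x y : nat) (F : nat -> R) (c : R) :
  (0 < q)%N -> (x <= y)%N ->
  (forall i, (x < i <= y)%N -> ~~ (q %| i)%N -> F i = c) ->
  \sum_(x.+1 <= i < y.+1 | ~~ (q %| i)%N) F i =
  ((qfree_count q y)%:R - (qfree_count q x)%:R) * c.
Proof.
move=> q0 xy Fc.
transitivity (\sum_(x.+1 <= i < y.+1 | ~~ (q %| i)%N) c).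
  rewrite big_nat_cond [RHS]big_nat_cond; apply: eq_bigr => i.
  by move=> /andP[xi qi]; apply: Fc.
rewrite !qfree_countE // [X in _ = (X - _) * _](@big_cat_nat _ _ _ x.+1) //=.
by rewrite addrAC subrr add0r mulr_suml; apply: eq_bigr => i _; rewrite mul1r.
Qed.

(** The intervals (N / q^(s+1), N / q^s] are adjacent. *)
Lemma sum_q_blocks (R : realType) (q N P : nat) (Q : pred nat) (F : nat -> R) :
  (0 < q)%N ->
  \sum_((N %/ q ^ P).+1 <= i < N.+1 | Q i) F i =
  \sum_(0 <= s < P)
     \sum_((N %/ q ^ s.+1).+1 <= i < (N %/ q ^ s).+1 | Q i) F i.
Proof.
move=> q0; elim: P => [|P IH].
  by rewrite big_nil expn0 divn1 big_geq.
rewrite big_nat_recr //= -IH (@big_cat_nat _ _ _ (N %/ q ^ P).+1) //=.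
- by rewrite addrC.
- by rewrite ltnS leq_div2l ?expn_gt0 ?q0 // leq_pexp2l.
- by rewrite ltnS leq_div.
Qed.

(** The sum over the group N / q^(s+1) < i <= N / q^s of the values F a (b - a):
    there b = s + 1, and for j <= s the threshold n / q^(s-j) tells whether a is
    s - j or s + 1 - j. *)
Definition block_sum (R : realType) (q j n N : nat) (F : nat -> nat -> R)
    (s : nat) : R :=
  if (s < j)%N then
    ((qfree_count q (N %/ q ^ s))%:R - (qfree_count q (N %/ q ^ s.+1))%:R)
      * F 0%N s.+1
  else
    ((qfree_count q (N %/ q ^ s))%:R - (qfree_count q (n %/ q ^ (s - j)))%:R)
      * F (s - j)%N j.+1 +
    ((qfree_count q (n %/ q ^ (s - j)))%:R
       - (qfree_count q (N %/ q ^ s.+1))%:R) * F (s.+1 - j)%N j.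

Lemma divn_exp_sub (q n j s : nat) : (0 < q)%N -> (j <= s)%N ->
  (n %/ q ^ (s - j) = (n * q ^ j) %/ q ^ s)%N.
Proof.
by move=> q0 js; rewrite -{2}(subnK js) expnD divnMr // expn_gt0 q0.
Qed.

Lemma sum_nterms (R : realType) (q j n N : nat) (F : nat -> nat -> R) :
  (1 < q)%N -> (n * q ^ j <= N <= n * q ^ j.+1)%N ->
  \sum_(1 <= i < N.+1 | ~~ (q %| i)%N)
     F (nterms q n i) (nterms q N i - nterms q n i)%N =
  \sum_(0 <= s < N) block_sum q j n N F s.
Proof.
move=> q1 /andP[nN Nn]; have q0 := ltnW q1.
have qs0 s : (0 < q ^ s)%N by rewrite expn_gt0 q0.
have divs s : (N %/ q ^ s.+1 <= N %/ q ^ s)%N.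
  by rewrite leq_div2l // leq_pexp2l.
(* N < q ^ N, so N groups exhaust the range 1, ..., N. *)
have {1}-> : 1%N = (N %/ q ^ N).+1 by rewrite divn_small // ltn_expl.
rewrite sum_q_blocks //; apply: eq_bigr => s _; rewrite /block_sum.
have bE i : (N %/ q ^ s.+1 < i <= N %/ q ^ s)%N -> ~~ (q %| i)%N ->
    nterms q N i = s.+1.
  move=> /andP[lo hi] qi; apply/eqP; rewrite eqn_leq nterms_le //=.
  by apply: nterms_gt => //; exact: leq_ltn_trans lo.
case: ltnP => sj.
  apply: sum_qfree_const => // i ib qi; rewrite (bE i ib qi).
  (* i > N / q^(s+1) >= n q^(j-s-1) >= n, so no letter is recorded. *)
  suff -> : nterms q n i = 0%N by [].
  apply/eqP; rewrite -leqn0; apply: nterms_le => //; rewrite expn0 divn1.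
  case/andP: ib => lo _; apply: leq_ltn_trans lo; rewrite leq_divRL //.
  by rewrite (leq_trans _ nN) // leq_mul2l leq_pexp2l ?orbT.
have nE := divn_exp_sub n q0 sj.
have hi : (n %/ q ^ (s - j) <= N %/ q ^ s)%N by rewrite nE leq_div2r.
have lo : (N %/ q ^ s.+1 <= n %/ q ^ (s - j))%N.
  rewrite -subSS divn_exp_sub ?ltnS //; exact: leq_div2r.
have i0 x i : (x < i)%N -> (0 < i)%N by exact: leq_ltn_trans.
rewrite (@big_cat_nat _ _ _ (n %/ q ^ (s - j)).+1) //= addrC; congr (_ + _).
  apply: sum_qfree_const => // i /andP[l r] qi.
  rewrite (bE i) // ?r ?(leq_ltn_trans lo) //.
  suff -> : nterms q n i = (s - j)%N by rewrite subSn ?leq_subr // subKn.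
  apply/eqP; rewrite eqn_leq nterms_le //=.
  move: sj; rewrite leq_eqVlt => /predU1P[->|js]; first by rewrite subnn.
  rewrite -(ltn_predK js) subSn // ?nterms_gt ?(i0 _ _ l) //; last first.
    by move: js; case: (s).
  apply: leq_trans r _; rewrite -subSS.
  have -> : (s.-1.+1 = s)%N by rewrite (ltn_predK js).
  by rewrite divn_exp_sub // leq_div2r.
apply: sum_qfree_const => // i /andP[l r] qi.
rewrite (bE i) // ?l ?(leq_trans r) //.
suff -> : nterms q n i = (s.+1 - j)%N by rewrite subKn // ltnW.
apply/eqP; rewrite eqn_leq (subSn sj) nterms_gt ?(i0 _ _ l) // andbT.
apply: nterms_le => //; apply: leq_ltn_trans l; rewrite -subSn //.
by rewrite divn_exp_sub ?(leqW sj) // leq_div2r.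
Qed.

(** * Limits *)

(** Dominated convergence for series.  The tail of the sum beyond a fixed P is
    at most the tail of the series of M, uniformly in n, and the first P terms
    converge one by one. *)
Lemma tannery (R : realType) (T : nat -> R^nat) (t M : R^nat)
    (K : nat -> nat) :
  (forall s, T n s @[n --> \oo] --> t s) ->
  (forall n s, `|T n s| <= M s) -> cvgn (series M) ->
  (forall n, (n <= K n)%N) ->
  cvgn (series t) /\
  \sum_(0 <= s < K n) T n s @[n --> \oo] --> limn (series t).
Proof.
move=> Tt TM cM nK.
have M0 s : 0 <= M s by exact: le_trans (TM 0%N s).
have tM s : `|t s| <= M s.
  apply: (cvgr_to_le (cvg_norm (Tt s))); near=> n; exact: TM.
have ct : cvgn (series t).
  by apply: normed_cvg; apply: series_le_cvg tM cM => s; rewrite /= ?normr_ge0.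
split=> //.
have ndM : nondecreasing_seq (series M).
  apply/nondecreasing_seqP => n; rewrite /series /= big_nat_recr //= lerDl.
  exact: M0.
apply/cvgrPdist_le => e e0.
have e3 : 0 < e / 3 by rewrite divr_gt0.
have [P [Pt PM]] : exists P, `|limn (series t) - series t P| <= e / 3 /\
    `|limn (series M) - series M P| <= e / 3.
  near \oo => P; exists P; split; near: P.
  - by move/cvgrPdist_le: ct; exact.
  - by move/cvgrPdist_le: cM; exact.
have TP : (\sum_(0 <= s < P) T n s) @[n --> \oo] --> \sum_(0 <= s < P) t s.
  by apply: cvg_big => [|s _]; [exact: add_continuous | exact: Tt].
move/cvgrPdist_le: TP => /(_ _ e3) TP.
near=> n.
have PK : (P <= K n)%N.
  by apply: leq_trans (nK n); near: n; exact: nbhs_infty_ge.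
rewrite (@big_cat_nat _ _ _ P) //=.
have Pn : `|\sum_(0 <= s < P) t s - \sum_(0 <= s < P) T n s| <= e / 3.
  by near: n.
have tail : `|\sum_(P <= s < K n) T n s| <= e / 3.
  apply: le_trans (ler_norm_sum _ _ _) _.
  apply: le_trans (ler_sum _ (fun s _ => TM n s)) _.
  rewrite -sub_series_geq //; apply: le_trans PM.
  apply: le_trans _ (ler_norm _); rewrite lerD2r.
  exact: nondecreasing_cvgn_le.
rewrite /series /= in Pt *.
set l := limn _ in Pt *; set a := \sum_(0 <= s < P) t s in Pt Pn.
set b := \sum_(0 <= s < P) _ in Pn *; set c := \sum_(P <= s < K n) _ in tail *.
have -> : l - (b + c) = (l - a) + ((a - b) - c) by ring.
apply: le_trans (ler_normD _ _) _; apply: le_trans (lerD Pt (ler_normB _ _)) _.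
by lra.
Unshelve. all: by end_near. Qed.

Lemma cvg_invn (R : realType) : (n%:R^-1 : R) @[n --> \oo] --> (0 : R).
Proof.
apply/gtr0_cvgV0; last exact: cvgr_idn.
by near=> n; rewrite ltr0n; near: n; exact: nbhs_infty_gt.
Unshelve. all: by end_near. Qed.

(** Rounding x n / d down changes it by less than 1, which is negligible
    compared with n. *)
Lemma cvg_divn (R : realType) (x : nat -> nat) (r : R) (d : nat) :
  (0 < d)%N -> n%:R^-1 * (x n)%:R @[n --> \oo] --> r ->
  n%:R^-1 * (x n %/ d)%:R @[n --> \oo] --> r / d%:R.
Proof.
move=> d0 xr; have d0' : d%:R != 0 :> R by rewrite pnatr_eq0 -lt0n.
have m0 : n%:R^-1 * (x n %% d)%:R @[n --> \oo] --> (0 : R).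
  apply: (@squeeze_cvgr _ _ _ _ (fun=> 0) (fun n => n%:R^-1 * d%:R)).
  - near=> n; rewrite mulr_ge0 ?invr_ge0 ?ler0n //=.
    by rewrite ler_wpM2l ?invr_ge0 ?ler0n // ler_nat ltnW // ltn_mod.
  - exact: cvg_cst.
  - rewrite -[X in _ --> X](mul0r d%:R); apply: cvgM; last exact: cvg_cst.
    exact: cvg_invn.
rewrite -[r]subr0.
under eq_fun => n.
  have -> : n%:R^-1 * (x n %/ d)%:R =
      (n%:R^-1 * (x n)%:R - n%:R^-1 * (x n %% d)%:R) / d%:R :> R.
    by rewrite {2}(divn_eq (x n) d) natrD natrM; move: (_^-1) => v; field.
  over.
by apply: cvgM; [exact: cvgB | exact: cvg_cst].
Unshelve. all: by end_near. Qed.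

Lemma cvg_qfree_count (R : realType) (q : nat) (x : nat -> nat) (r : R) :
  (0 < q)%N -> n%:R^-1 * (x n)%:R @[n --> \oo] --> r ->
  n%:R^-1 * (qfree_count q (x n))%:R @[n --> \oo] --> r * (1 - q%:R^-1).
Proof.
move=> q0 xr; rewrite mulrBr mulr1.
under eq_fun do rewrite /qfree_count natrB ?leq_div // mulrBr.
by apply: cvgB => //; exact: cvg_divn.
Qed.

(** * The lengths L n *)

Lemma gamma_gt0 (R : realType) (m1 m2 : nat) : (2 <= m2)%N -> (m2 < m1)%N ->
  0 < gamma R m1 m2.
Proof.
move=> hm2 hm1.
by rewrite divr_gt0 // ln_gt0 // ltr1n // (leq_trans hm2) // ltnW.
Qed.

Lemma L_itv (R : realType) (m1 m2 n : nat) : 0 < gamma R m1 m2 ->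
  n%:R / gamma R m1 m2 <= (L R m1 m2 n)%:R < n%:R / gamma R m1 m2 + 1.
Proof.
move=> g0; rewrite /L; set x := _ / _.
have x0 : 0 <= x by rewrite divr_ge0 // ltW.
have c0 : 0 <= Num.ceil x by rewrite ceil_ge0 (lt_le_trans _ x0) // ltrN10.
have -> : (`|Num.ceil x|%N)%:R = (Num.ceil x)%:~R :> R.
  by rewrite natr_absz ger0_norm.
by rewrite ceil_ge /= -ltrBlDr -(intrB R _ 1) ceilB1_lt.
Qed.

(** The two bounds on 1 / gamma pass to N = L n without any error term because
    n q^j and n q^(j+1) are integers and N is n / gamma rounded up. *)
Lemma L_bounds (R : realType) (q m1 m2 j n : nat) : 0 < gamma R m1 m2 ->
  q%:R ^+ j <= (gamma R m1 m2)^-1 < q%:R ^+ j.+1 ->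
  (n * q ^ j <= L R m1 m2 n <= n * q ^ j.+1)%N.
Proof.
move=> g0 /andP[qj qj1]; have /andP[Ln nL] := L_itv n g0.
apply/andP; split.
  rewrite -(ler_nat R) natrM natrX; apply: le_trans Ln.
  by rewrite ler_wpM2l.
rewrite -ltnS -(ltr_nat R) -addn1 natrD natrM natrX; apply: lt_le_trans nL _.
by rewrite lerD2r ler_wpM2l // ltW.
Qed.

Lemma cvg_L (R : realType) (m1 m2 : nat) : 0 < gamma R m1 m2 ->
  n%:R^-1 * (L R m1 m2 n)%:R @[n --> \oo] --> (gamma R m1 m2)^-1.
Proof.
move=> g0; apply: (@squeeze_cvgr _ _ _ _ (fun=> (gamma R m1 m2)^-1)
    (fun n => (gamma R m1 m2)^-1 + n%:R^-1)).
- near=> n; have n0 : (0 : R) < n%:R.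
    by rewrite ltr0n; near: n; exact: nbhs_infty_gt.
  have /andP[Ln nL] := L_itv n g0.
  rewrite [n%:R^-1 * _]mulrC ler_pdivlMr // ler_pdivrMr // mulrDl.
  by rewrite mulVf ?gt_eqF // [_^-1 * n%:R]mulrC Ln ltW.
- exact: cvg_cst.
- rewrite -[X in _ --> X]addr0; apply: cvgD; [exact: cvg_cst|exact: cvg_invn].
Unshelve. all: by end_near. Qed.

Lemma cvg_id_ratio (R : realType) : n%:R^-1 * n%:R @[n --> \oo] --> (1 : R).
Proof.
apply: cvg_near_cst; near=> n; rewrite mulVf // pnatr_eq0 -lt0n.
by near: n; exact: nbhs_infty_gt.
Unshelve. all: by end_near. Qed.

(** * Limits and bounds of the groups *)

(** With s = p - 1, these are the terms of the three sums in the dimension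
    formula. *)
Definition block_lim (R : realType) (q j : nat) (g : R) (F : nat -> nat -> R)
    (s : nat) : R :=
  if (s < j)%N then (q%:R - 1) ^+ 2 / q%:R ^+ s.+2 * F 0%N s.+1
  else
    (q%:R - 1) * (1 - q%:R ^+ j * g) / q%:R ^+ s.+1 * F (s - j)%N j.+1 +
    (q%:R - 1) * (q%:R ^+ j.+1 * g - 1) / q%:R ^+ s.+2 * F (s.+1 - j)%N j.

Lemma cvg_block_sum (R : realType) (q j s : nat) (g : R) (N : nat -> nat)
    (F : nat -> nat -> R) : (0 < q)%N -> 0 < g ->
  n%:R^-1 * (N n)%:R @[n --> \oo] --> g^-1 ->
  g * (n%:R^-1 * block_sum q j n (N n) F s) @[n --> \oo] -->
  block_lim q j g F s.
Proof.
move=> q0 g0 Ng.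
have q0' : q%:R != 0 :> R by rewrite pnatr_eq0 -lt0n.
have qs0 k : (0 < q ^ k)%N by rewrite expn_gt0 q0.
have cN k := cvg_qfree_count q0 (cvg_divn (qs0 k) Ng).
have cn k := cvg_qfree_count q0 (cvg_divn (qs0 k) (@cvg_id_ratio R)).
have g0' : g != 0 by rewrite gt_eqF.
rewrite /block_sum /block_lim; case: ltnP => sj.
  rewrite [X in _ --> X](_ : _ = g * ((g^-1 / (q ^ s)%:R * (1 - q%:R^-1) -
      g^-1 / (q ^ s.+1)%:R * (1 - q%:R^-1)) * F 0%N s.+1)); last first.
    by rewrite !natrX !exprS; field; rewrite ?g0' ?q0' ?expf_neq0.
  apply: cvgM; first exact: cvg_cst.
  under eq_fun do rewrite mulrA mulrBr.
  by apply: cvgM; [exact: cvgB | exact: cvg_cst].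
rewrite [X in _ --> X](_ : _ = g * (
  (g^-1 / (q ^ s)%:R * (1 - q%:R^-1) - 1 / (q ^ (s - j))%:R * (1 - q%:R^-1)) *
    F (s - j)%N j.+1 +
  (1 / (q ^ (s - j))%:R * (1 - q%:R^-1) -
     g^-1 / (q ^ s.+1)%:R * (1 - q%:R^-1)) * F (s.+1 - j)%N j)); last first.
  rewrite [q%:R ^+ j.+1]exprS.
  have -> : q%:R ^+ j = q%:R ^+ s / q%:R ^+ (s - j) :> R.
    by rewrite -{1}(subnK sj) exprD mulrAC mulfV ?expf_neq0 // mul1r.
  by rewrite !natrX !exprS; field; rewrite ?g0' ?q0' ?expf_neq0.
apply: cvgM; first exact: cvg_cst.
under eq_fun do rewrite mulrDr !mulrA !mulrBr.
by apply: cvgD; apply: cvgM;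
  [exact: cvgB | exact: cvg_cst | exact: cvgB | exact: cvg_cst].
Qed.

Lemma ler_qfree_count (R : realType) (q x y : nat) : (0 < q)%N -> (x <= y)%N ->
  (qfree_count q x)%:R <= (qfree_count q y)%:R :> R.
Proof.
move=> q0 xy; rewrite -subr_ge0 -[X in 0 <= X]mulr1.
by rewrite -(@sum_qfree_const R q x y (fun=> 1) 1) // sumr_ge0.
Qed.

(** The pieces together contain at most N / q^s <= n q^(j+1) / q^s indices, and
    on each of them the two arguments of F add up to s + 1. *)
Lemma block_sum_bounds (R : realType) (q j n N s : nat) (F : nat -> nat -> R)
    (C : R) : (0 < q)%N -> (n * q ^ j <= N <= n * q ^ j.+1)%N -> 0 <= C ->
  (forall a b, 0 <= F a b <= C * (a + b)%:R) ->
  0 <= block_sum q j n N F s <= n%:R * q%:R ^+ j.+1 / q%:R ^+ s * (C * s.+1%:R).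
Proof.
move=> q0 /andP[nN Nn] C0 FC.
have qs0 k : (0 < q ^ k)%N by rewrite expn_gt0 q0.
have qR0 k : 0 < q%:R ^+ k :> R by rewrite exprn_gt0 // ltr0n.
have top :
    (qfree_count q (N %/ q ^ s))%:R <= n%:R * q%:R ^+ j.+1 / q%:R ^+ s :> R.
  rewrite ler_pdivlMr // -natrX -natrX -!natrM ler_nat.
  apply: leq_trans Nn; apply: leq_trans (leq_divM N (q ^ s)).
  rewrite leq_mul2r.
  by rewrite leq_subr orbT.
have divs : (N %/ q ^ s.+1 <= N %/ q ^ s)%N.
  by rewrite leq_div2l // leq_pexp2l.
have U0 x : 0 <= (qfree_count q x)%:R :> R by exact: ler0n.
have CS : 0 <= C * s.+1%:R by rewrite mulr_ge0.
rewrite /block_sum; case: ltnP => sj.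
  have /andP[F0 FS] := FC 0%N s.+1; rewrite add0n in FS.
  have d := ler_qfree_count R q0 divs.
  rewrite mulr_ge0 ?subr_ge0 //= ler_pM ?subr_ge0 //.
  by apply: le_trans top; rewrite gerDl oppr_le0.
have hi : (n %/ q ^ (s - j) <= N %/ q ^ s)%N.
  by rewrite divn_exp_sub // leq_div2r.
have lo : (N %/ q ^ s.+1 <= n %/ q ^ (s - j))%N.
  rewrite -subSS divn_exp_sub ?ltnS //; exact: leq_div2r.
have /andP[F0 FS] := FC (s - j)%N j.+1; rewrite addnS subnK // in FS.
have /andP[G0 GS] := FC (s.+1 - j)%N j; rewrite subnK ?leqW // in GS.
have := ler_qfree_count R q0 hi; have := ler_qfree_count R q0 lo.
rewrite -subr_ge0 => lo'; rewrite -subr_ge0 => hi'.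
rewrite addr_ge0 ?mulr_ge0 //=.
apply: le_trans (lerD (ler_wpM2l hi' FS) (ler_wpM2l lo' GS)) _.
rewrite -mulrDl ler_wpM2r // addrA subrK.
by apply: le_trans top; rewrite gerDl oppr_le0.
Qed.

(** Part of the decay of q ^ - s <= 2 ^ - s absorbs the factor s + 1:
    s + 1 <= 2 (3/2)^s, and (3/2) / 2 = 3/4 is still smaller than 1. *)
Lemma poly_geom_bound (R : realType) (q s : nat) : (1 < q)%N ->
  s.+1%:R / q%:R ^+ s <= geometric 2 (3 / 4) s :> R.
Proof.
move=> q1.
have h : s.+1%:R <= 2 * (3 / 2) ^+ s :> R.
  have x1 k : 1 <= (3 / 2) ^+ k :> R by rewrite exprn_ege1 //; lra.
  elim: s => [|s IH]; first by rewrite expr0; lra.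
  by rewrite exprS -natr1; have := x1 s; lra.
have q2 : (2 : R) ^+ s <= q%:R ^+ s.
  by rewrite lerXn2r ?nnegrE ?ler0n // ler_nat.
have p2 : 0 < (2 : R) ^+ s by rewrite exprn_gt0.
rewrite /= ler_pdivrMr ?(lt_le_trans p2) //; apply: le_trans h _.
rewrite -mulrA ler_pM2l ?ltr0n //.
have -> : (3 / 2 : R) ^+ s = (3 / 4) ^+ s * 2 ^+ s.
  by rewrite -exprMn; congr (_ ^+ _); field.
by rewrite ler_wpM2l // exprn_ge0 // divr_ge0.
Qed.

Lemma logb_card_Pref (R : realType) (m1 m2 p l : nat) (Y : set (Sigma m1 m2)) :
  (2 <= m2)%N -> (m2 < m1)%N -> Y !=set0 ->
  0 <= logb (m2%:R : R) #|Pref p l Y|%:R <=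
       logb m2%:R (m1 * m2)%:R * (p + l)%:R.
Proof.
move=> hm2 hm1 [z Yz].
have lm2 : 0 < ln m2%:R :> R by rewrite ln_gt0 // ltr1n.
have m0 : (0 < m1 * m2)%N.
  by rewrite muln_gt0 !(leq_trans _ hm2) // (leq_trans _ hm1).
have c0 : (0 < #|Pref p l Y|)%N.
  by apply/card_gt0P; exists (prefix_word p l z); apply/PrefP; exists z.
have c1 : (#|Pref p l Y| <= (m1 * m2) ^ (p + l))%N.
  apply: leq_trans (max_card _) _.
  rewrite card_prod !card_tuple card_prod !card_ord expnD leq_mul2l.
  case: (l) => [|l']; first by rewrite leqnn orbT.
  by rewrite leq_exp2r // leq_pmull ?orbT // (leq_trans _ hm1).
rewrite /logb; apply/andP; split.
  by rewrite divr_ge0 ?(ltW lm2) ?ln_ge0 ?ler1n.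
rewrite mulrAC ler_pM2r ?invr_gt0 // mulr_natr -lnXn ?ltr0n // -natrX.
by rewrite ler_ln ?posrE ?ltr0n ?expn_gt0 ?m0 // ler_nat.
Qed.

(** * The dimension of X_Omega *)

(** The factor gamma converts logarithms in base m2 to base m1. *)
Lemma log_cover_X (R : realType) (q m1 m2 j n : nat)
    (Omega : set (Sigma m1 m2)) :
  (1 < q)%N -> (2 <= m2)%N -> (m2 < m1)%N ->
  q%:R ^+ j <= (gamma R m1 m2)^-1 < q%:R ^+ j.+1 -> Omega !=set0 ->
  log_cover R (X_ q Omega) n =
  \sum_(0 <= s < L R m1 m2 n) gamma R m1 m2 * (n%:R^-1 *
    block_sum q j n (L R m1 m2 n)
      (fun a b => logb m2%:R #|Pref a b Omega|%:R) s).
Proof.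
move=> q1 hm2 hm1 hj One; have g0 := gamma_gt0 R hm2 hm1.
have nN := L_bounds n g0 hj.
have nL : (n <= L R m1 m2 n)%N.
  case/andP: nN => + _; apply: leq_trans.
  by rewrite leq_pmulr // expn_gt0 (ltnW q1).
have lnm2 : ln m2%:R != 0 :> R by rewrite gt_eqF // ln_gt0 // ltr1n.
rewrite -!mulr_sumr -(sum_nterms _ q1 nN) mulrCA /log_cover; congr (_ * _).
rewrite card_Pref_X // /logb -mulr_suml.
rewrite /gamma [RHS]mulrCA [X in _ = _ * X]mulrAC mulfV // mul1r; congr (_ / _).
rewrite natr_prod; set N := L R m1 m2 n.
pose k i := #|Pref (nterms q n i) (nterms q N i - nterms q n i) Omega|.
(* ln is additive on products of positive numbers only, so positivity of the
   partial products is proved along with the formula. *)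
apply: (@proj2
  (0 < \prod_(1 <= i < N.+1 | ~~ (q %| i)%N) (k i)%:R :> R)).
elim/big_rec2: _ => [|i x y qi [y0 xy]]; first by rewrite ln1 ltr01.
have c0 : 0 < (k i)%:R :> R.
  rewrite ltr0n; apply/card_gt0P; case: One => z Oz.
  by exists (prefix_word _ _ z); apply/PrefP; exists z.
by rewrite mulr_gt0 // lnM ?posrE // xy.
Qed.

Lemma cvg_log_cover_X (R : realType) (q m1 m2 j : nat)
    (Omega : set (Sigma m1 m2)) :
  (1 < q)%N -> (2 <= m2)%N -> (m2 < m1)%N ->
  q%:R ^+ j <= (gamma R m1 m2)^-1 < q%:R ^+ j.+1 -> Omega !=set0 ->
  let t := block_lim q j (gamma R m1 m2)
    (fun a b => logb m2%:R #|Pref a b Omega|%:R) in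
  cvgn (series t) /\
  log_cover R (X_ q Omega) n @[n --> \oo] --> limn (series t).
Proof.
move=> q1 hm2 hm1 hj One t; have g0 := gamma_gt0 R hm2 hm1.
have q0 := ltnW q1.
under eq_fun do rewrite (log_cover_X _ q1 hm2 hm1 hj One).
pose C : R := logb m2%:R (m1 * m2)%:R.
pose A : R := gamma R m1 m2 * (q%:R ^+ j.+1 * C).
have C0 : 0 <= C.
  rewrite divr_ge0 ?ln_ge0 ?ler1n // ?muln_gt0 ?(ltnW hm2) //.
  by rewrite (leq_trans _ hm1).
have A0 : 0 <= A.
  by apply: mulr_ge0 (ltW g0) (mulr_ge0 _ C0); exact: exprn_ge0.
apply: (@tannery R _ t (geometric (A * 2) (3 / 4))).
- by move=> s; apply: cvg_block_sum => //; exact: cvg_L.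
- move=> n s; have [->|n0] := posnP n.
    rewrite invr0 mul0r mulr0 normr0 /=.
    by apply: mulr_ge0; [exact: mulr_ge0 | rewrite exprn_ge0 // divr_ge0].
  have /andP[b0 bM] := block_sum_bounds s q0 (L_bounds n g0 hj) C0
    (fun a b => logb_card_Pref R a b hm2 hm1 One).
  rewrite ger0_norm; last first.
    by apply: mulr_ge0 (ltW g0) _; rewrite mulr_ge0 ?invr_ge0.
  apply: (@le_trans _ _ (A * (s.+1%:R / q%:R ^+ s))).
    rewrite /A -[X in _ <= X]mulrA ler_pM2l // ler_pdivrMl ?ltr0n //.
    by move: bM; congr (_ <= _); ring.
  apply: le_trans (ler_wpM2l A0 (poly_geom_bound R s q1)) _.
  by rewrite /= mulrA.
- by apply: is_cvg_geometric_series; rewrite ger0_norm; lra.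
- move=> n; have /andP[+ _] := L_bounds n g0 hj; apply: leq_trans.
  by rewrite leq_pmulr // expn_gt0 q0.
Qed.

Theorem theorem2p11 (R : realType) (q m1 m2 j : nat)
    (hq : (2 <= q)%N) (hm2 : (2 <= m2)%N) (hm1 : (m2 < m1)%N)
    (hj : q%:R ^+ j <= (gamma R m1 m2)^-1 < q%:R ^+ j.+1)
    (Omega : set (Sigma m1 m2))
    (hne : Omega !=set0) (hcl : closed Omega) :
  has_minkowski_dim (X_ q Omega)
    (((q%:R - 1) ^+ 2 *
        \sum_(1 <= p < j.+1)
           logb m2%:R #|Pref 0 p Omega|%:R / q%:R ^+ p.+1)%:E
     + ((q%:R - 1) * (1 - q%:R ^+ j * gamma R m1 m2))%:E *
        \sum_(j.+1 <= p <oo)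
           (logb m2%:R #|Pref (p - j - 1) j.+1 Omega|%:R / q%:R ^+ p)%:E
     + ((q%:R - 1) * (q%:R ^+ j.+1 * gamma R m1 m2 - 1))%:E *
        \sum_(j.+1 <= p <oo)
           (logb m2%:R #|Pref (p - j) j Omega|%:R / q%:R ^+ p.+1)%:E)%E.
Proof.
have g0 := gamma_gt0 R hm2 hm1.
have [] := cvg_log_cover_X hq hm2 hm1 hj hne.
set c := fun a b => logb m2%:R _; set t := block_lim _ _ _ _ => ct lt.
have c0 a b : 0 <= c a b by case/andP: (logb_card_Pref R a b hm2 hm1 hne).
have /andP[qg gq] := hj.
have q1 : 0 <= q%:R - 1 :> R by rewrite subr_ge0 ler1n ltnW.
have w1 : 0 <= 1 - q%:R ^+ j * gamma R m1 m2.
  by rewrite subr_ge0 -ler_pdivlMr // div1r.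
have w2 : 0 <= q%:R ^+ j.+1 * gamma R m1 m2 - 1.
  by rewrite subr_ge0 -ler_pdivrMr // div1r ltW.
have qV0 k : 0 <= (q%:R ^+ k)^-1 :> R by rewrite invr_ge0 exprn_ge0.
have t0 s : 0 <= t s.
  rewrite /t /block_lim; case: ifP => _; first by
    rewrite mulr_ge0 // mulr_ge0 // exprn_ge0.
  by apply: addr_ge0; rewrite mulr_ge0 // mulr_ge0 // mulr_ge0.
suff -> : (((q%:R - 1) ^+ 2 * \sum_(1 <= p < j.+1) c 0%N p / q%:R ^+ p.+1)%:E
     + ((q%:R - 1) * (1 - q%:R ^+ j * gamma R m1 m2))%:E *
        \sum_(j.+1 <= p <oo) (c (p - j - 1)%N j.+1 / q%:R ^+ p)%:E
     + ((q%:R - 1) * (q%:R ^+ j.+1 * gamma R m1 m2 - 1))%:E *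
        \sum_(j.+1 <= p <oo) (c (p - j)%N j / q%:R ^+ p.+1)%:E)%E
   = (limn (series t))%:E.
  have lE : (log_cover R (X_ q Omega) n)%:E @[n --> \oo]
      --> (limn (series t))%:E.
    exact: (cvg_comp _ _ lt).
  by have [linf lsup] := cvg_limn_einf_sup lE; split.
rewrite -EFin_lim //.
transitivity (\sum_(0 <= s <oo) (t s)%:E)%E; last first.
  by congr (limn _); apply/funext => n; rewrite /= sumEFin.
(* The first j terms give the finite sum, the others the two series. *)
rewrite (@nneseries_split _ _ 0 j) ?add0n; last by move=> k _; rewrite lee_fin.
rewrite -addeA; congr (_ + _)%E.
  rewrite sumEFin; congr EFin; rewrite big_add1 /= mulr_sumr.
  apply: eq_big_nat => s /andP[_ sj].
  by rewrite /t /block_lim sj mulrA mulrAC.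
pose f1 p : \bar R := (c (p - j - 1)%N j.+1 / q%:R ^+ p)%:E.
pose f2 p : \bar R := (c (p - j)%N j / q%:R ^+ p.+1)%:E.
have f10 p : (0 <= f1 p)%E by rewrite lee_fin mulr_ge0.
have f20 p : (0 <= f2 p)%E by rewrite lee_fin mulr_ge0.
rewrite -(nneseries_addn j.+1 f10) -(nneseries_addn j.+1 f20).
rewrite -(@nneseries_addn _ (fun s => (t s)%:E) j); last first.
  by move=> s; rewrite lee_fin.
rewrite -(nneseriesZl (P := xpredT) _ _ (fun i _ => f10 (i + j.+1)%N)).
rewrite -(nneseriesZl (P := xpredT) _ _ (fun i _ => f20 (i + j.+1)%N)).
rewrite -nneseriesD; last 2 first.
- by move=> i _ _; apply: mule_ge0; rewrite ?f10 // lee_fin mulr_ge0.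
- by move=> i _ _; apply: mule_ge0; rewrite ?f20 // lee_fin mulr_ge0.
apply: eq_eseriesr => s _; rewrite /f1 /f2 -!EFinM -EFinD; congr EFin.
rewrite /t /block_lim ltnNge leq_addl /= !addnS subSn ?leq_addl // addnK.
rewrite subn1 /=.
by congr (_ + _); rewrite mulrA mulrAC.
Qed.
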